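(* (Budget Balance) Consider the joint electricity-carbon market defined in the context, with $\Delta\mathcal{S}=\mathcal{S}_2+\mathcal{S}_3$ and $\mathcal{S}=\mathcal{S}_1+\mathcal{S}_2+\mathcal{S}_3$ regarded as functions of the parameter $\delta$. There exists $\delta\in[0,1)$ such that $\Delta\mathcal{S}=0$. Moreover, at such a $\delta$, if there is no power network congestion (i.e., none of the line inequalities $-F_l\le \sum_{i}\pi_{il}p_i^*-\sum_j\pi_{jl}d_j^*\le F_l$, $l\in\mathcal{L}$, is binding), then $\mathcal{S}=0$.
   Context: Data: finite sets $\mathcal{I}$ (generators), $\mathcal{J}$ (loads), $\mathcal{L}$ (lines); real marginal generation costs $c_i$, emission factors $e_i\ge 0$, maximum productions $\overline{P}_i\ge 0$ ($i\in\mathcal{I}$); real marginal utilities $b_j$, maximum consumptions $\overline{D}_j\ge 0$ ($j\in\mathcal{J}$); line capacities $F_l\ge 0$ and real node-to-line transfer factors $\pi_{il},\pi_{jl}$ ($l\in\mathcal{L}$); a coefficient $\kappa\ge0$ converting emissions into money; a parameter $\delta\in[0,1]$. Carbon-aware social welfare maximization (SW): $$O^*=\max_{p,d}\ \sum_{j}b_jd_j-\sum_i(c_i+\kappa e_i)p_i$$ subject to $\sum_i p_i=\sum_j d_j$; $0\le p_i\le\overline{P}_i$ for all $i$; $0\le d_j\le\overline{D}_j$ for all $j$; $-F_l\le\sum_i\pi_{il}p_i-\sum_j\pi_{jl}d_j\le F_l$ for all $l$. Its optimal dispatch is denoted $(p^*,d^* )$; it is assumed unique. Market-clearing problem (MC$_\delta$),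 in variables $p,d,\lambda,\underline\mu,\overline\mu,\underline\phi,\overline\phi,\underline\chi,\overline\chi$: $$\max\ \sum_j b_jd_j-\sum_i(c_i+\delta\kappa e_i)p_i$$ subject to (a) $\sum_ip_i=\sum_jd_j$ [multiplier $\tau\in\mathbb{R}$]; (b) $0\le p_i\le\overline{P}_i$ for all $i$; (c) $0\le d_j\le\overline{D}_j$ for all $j$; (d) $-F_l\le\sum_i\pi_{il}p_i-\sum_j\pi_{jl}d_j\le F_l$ for all $l$ [multipliers $\underline\alpha_l\ge0$ for the lower inequality, $\overline\alpha_l\ge0$ for the upper inequality]; (e) $-\lambda-\underline\mu_i+\overline\mu_i-\sum_l\pi_{il}(\overline\chi_l-\underline\chi_l)=-(c_i+\kappa e_i)$ for all $i$; (f) $\lambda-\underline\phi_j+\overline\phi_j+\sum_l\pi_{jl}(\overline\chi_l-\underline\chi_l)=b_j$ for all $j$; (g) $\underline\mu,\overline\mu,\underline\phi,\overline\phi,\underline\chi,\overline\chi\ge0$; (h) $\sum_i\overline\mu_i\overline{P}_i+\sum_j\overline\phi_j\overline{D}_j+\sum_l(\overline\chi_l+\underline\chi_l)F_l\le\sum_jb_jd_j-\sum_i(c_i+\kappa e_i)p_i$ [multiplier $\eta\ge0$]. Constraints (a)-(h) are the primal-dual optimality conditions of (SW), so the optimal dispatch of (MC$_\delta$) is $(p^*,d^* )$. Lagrangian dual: minimize over $\tau\in\mathbb{R}$, $\underline\alpha,\overline\alpha\ge0$, $\eta\ge0$ the maximum of $\mathscr{L}$ over $(p,d)$ satisfying (b),(c)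 and $(\lambda,\underline\mu,\overline\mu,\underline\phi,\overline\phi,\underline\chi,\overline\chi)$ satisfying (e)-(g), where $$\begin{aligned}\mathscr{L}=&\sum_jb_jd_j-\sum_i(c_i+\delta\kappa e_i)p_i+\tau\Big(\sum_ip_i-\sum_jd_j\Big)\\&+\sum_l\underline\alpha_l\Big(F_l+\sum_i\pi_{il}p_i-\sum_j\pi_{jl}d_j\Big)+\sum_l\overline\alpha_l\Big(F_l-\sum_i\pi_{il}p_i+\sum_j\pi_{jl}d_j\Big)\\&+\eta\Big(-\sum_i\overline\mu_i\overline{P}_i-\sum_j\overline\phi_j\overline{D}_j-\sum_l(\overline\chi_l+\underline\chi_l)F_l+\sum_jb_jd_j-\sum_i(c_i+\kappa e_i)p_i\Big).\end{aligned}$$ $(\tau^*,\underline\alpha^*,\overline\alpha^*,\eta^* )$ denotes an optimal solution of this dual (depending on $\delta$); if the optimal $\eta$ is not unique, $\eta^*$ is taken to be the smallest one among all dual optimal solutions. Prices: generator $i$ is paid $\lambda_i^{\rm pro}=\tau^*+\sum_l(\underline\alpha_l^*-\overline\alpha_l^* )\pi_{il}-\eta^*(c_i+\kappa e_i)$ per unit and pays a carbon tax at rate $\delta\kappa$ (i.e. $\delta\kappa e_ip_i$); load $j$ pays $\lambda_j^{\rm pro}=\tau^*+\sum_l(\underline\alpha_l^*-\overline\alpha_l^* )\pi_{jl}-\eta^*b_j$ per unit. Subsidy: $\mathcal{S}=\sum_i\lambda_i^{\rm pro}p_i^*-\sum_i\delta\kappa e_ip_i^*-\sum_j\lambda_j^{\rm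 pro}d_j^*=\mathcal{S}_1+\mathcal{S}_2+\mathcal{S}_3$, with $\mathcal{S}_1=\sum_l(\underline\alpha_l^*-\overline\alpha_l^* )\big(\sum_i\pi_{il}p_i^*-\sum_j\pi_{jl}d_j^*\big)$, $\mathcal{S}_2=-\delta\kappa\sum_ie_ip_i^*$, $\mathcal{S}_3=\eta^*\big(-\sum_i(c_i+\kappa e_i)p_i^*+\sum_jb_jd_j^*\big)$. *)

(* Defs.v *)
From HB Require Import structures.
From mathcomp Require Import all_boot all_order all_algebra.
From mathcomp Require Import classical_sets reals ring.

Set Implicit Arguments.
Unset Strict Implicit.
Unset Printing Implicit Defensive.
Import Order.TTheory GRing.Theory Num.Theory.
Local Open Scope ring_scope.

Record market (R : realType) (I J L : finType) := Market {
  cost : I -> R;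
  emission : I -> R;
  pmax : I -> R;
  utility : J -> R;
  dmax : J -> R;
  capacity : L -> R;
  gen_factor : I -> L -> R;
  load_factor : J -> L -> R;
  kappa : R;
  emission_ge0 : forall i, 0 <= emission i;
  pmax_ge0 : forall i, 0 <= pmax i;
  dmax_ge0 : forall j, 0 <= dmax j;
  capacity_ge0 : forall l, 0 <= capacity l;
  kappa_ge0 : 0 <= kappa }.

Record dispatch (R : realType) (I J : finType) := Dispatch {
  production : {ffun I -> R};
  consumption : {ffun J -> R} }.

(* The variables of the dual of the welfare problem, which are decision
   variables of the market-clearing problem. *)
Record shadow (R : realType) (I J L : finType) := Shadow {
  lam : R;
  mu_lo : {ffun I -> R};
  mu_up : {ffun I -> R};
  phi_lo : {ffun J -> R};
  phi_up : {ffun J -> R};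
  chi_lo : {ffun L -> R};
  chi_up : {ffun L -> R} }.

(* The multipliers of the dualized market-clearing constraints: power balance,
   the two line limits, and the welfare duality-gap constraint. *)
Record multipliers (R : realType) (L : finType) := Multipliers {
  tau : R;
  alpha_lo : {ffun L -> R};
  alpha_up : {ffun L -> R};
  eta : R }.

Section Market.
Variables (R : realType) (I J L : finType) (M : market R I J L).
Implicit Types (x : dispatch R I J) (s : shadow R I J L).
Implicit Types (y : multipliers R L) (delta : R).

(* Carbon is charged at rate r: r = kappa gives the social welfare, and
   r = delta * kappa the market-clearing objective. *)
Definition welfare (r : R) x : R :=
  \sum_j utility M j * consumption x j
  - \sum_i (cost M i + r * emission M i) * production x i.

Definition flow x (l : L) : R :=
  \sum_i gen_factor M i l * production x i
  - \sum_j load_factor M j l * consumption x j.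

Definition in_box x : Prop :=
  (forall i, 0 <= production x i <= pmax M i) /\
  (forall j, 0 <= consumption x j <= dmax M j).

Definition sw_feasible x : Prop :=
  [/\ \sum_i production x i = \sum_j consumption x j,
      in_box x &
      forall l, - capacity M l <= flow x l <= capacity M l].

Definition sw_optimal x : Prop :=
  sw_feasible x /\
  forall x', sw_feasible x' -> welfare (kappa M) x' <= welfare (kappa M) x.

(* With these signs chi_up prices the lower line limit and chi_lo the upper
   one; the cost below is symmetric in the two, so this is only a naming. *)
Definition shadow_feasible s : Prop :=
  [/\ forall i, - lam s - mu_lo s i + mu_up s i
                - \sum_l gen_factor M i l * (chi_up s l - chi_lo s l)
                = - (cost M i + kappa M * emission M i),
      forall j, lam s - phi_lo s j + phi_up s j
                + \sum_l load_factor M j l * (chi_up s l - chi_lo s l)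
                = utility M j,
      forall i, 0 <= mu_lo s i /\ 0 <= mu_up s i,
      forall j, 0 <= phi_lo s j /\ 0 <= phi_up s j &
      forall l, 0 <= chi_lo s l /\ 0 <= chi_up s l].

Definition shadow_cost s : R :=
  \sum_i mu_up s i * pmax M i + \sum_j phi_up s j * dmax M j
  + \sum_l (chi_up s l + chi_lo s l) * capacity M l.

Definition lagrangian delta y x s : R :=
  welfare (delta * kappa M) x
  + tau y * (\sum_i production x i - \sum_j consumption x j)
  + \sum_l alpha_lo y l * (capacity M l + flow x l)
  + \sum_l alpha_up y l * (capacity M l - flow x l)
  + eta y * (- shadow_cost s + welfare (kappa M) x).

Definition dual_feasible y : Prop :=
  (forall l, 0 <= alpha_lo y l /\ 0 <= alpha_up y l) /\ 0 <= eta y.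

Definition lagrangian_values delta y : set R :=
  [set v | exists x s,
     [/\ in_box x, shadow_feasible s & v = lagrangian delta y x s]]%classic.

Definition dual_value delta y (v : R) : Prop :=
  lagrangian_values delta y v /\ ubound (lagrangian_values delta y) v.

(* Multipliers at which the inner maximum does not exist have no dual value
   and do not compete in the minimization. *)
Definition dual_values delta : set R :=
  [set v | exists2 y, dual_feasible y & dual_value delta y v]%classic.

Definition dual_optimal delta y : Prop :=
  dual_feasible y /\
  exists2 v, dual_value delta y v & lbound (dual_values delta) v.

Definition price_multipliers delta y : Prop :=
  dual_optimal delta y /\
  forall y', dual_optimal delta y' -> eta y <= eta y'.

Definition gen_price y (i : I) : R :=
  tau y + \sum_l (alpha_lo y l - alpha_up y l) * gen_factor M i l
  - eta y * (cost M i + kappa M * emission M i).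

Definition load_price y (j : J) : R :=
  tau y + \sum_l (alpha_lo y l - alpha_up y l) * load_factor M j l
  - eta y * utility M j.

Definition subsidy delta y x : R :=
  \sum_i gen_price y i * production x i
  - \sum_i delta * kappa M * emission M i * production x i
  - \sum_j load_price y j * consumption x j.

Definition subsidy1 y x : R :=
  \sum_l (alpha_lo y l - alpha_up y l) * flow x l.

Definition subsidy2 delta x : R :=
  - (delta * kappa M * \sum_i emission M i * production x i).

Definition subsidy3 y x : R := eta y * welfare (kappa M) x.

Definition delta_subsidy delta y x : R := subsidy2 delta x + subsidy3 y x.

Definition uncongested x : Prop :=
  forall l, flow x l <> - capacity M l /\ flow x l <> capacity M l.

Lemma subsidyE delta y x : \sum_i production x i = \sum_j consumption x j ->
  subsidy delta y x = subsidy1 y x + subsidy2 delta x + subsidy3 y x.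
Proof.
move=> bal.
have price (K : finType) (g : K -> L -> R) (u z : K -> R) :
    \sum_k (tau y + \sum_l (alpha_lo y l - alpha_up y l) * g k l
            - eta y * u k) * z k
    = tau y * (\sum_k z k)
      + \sum_l (alpha_lo y l - alpha_up y l) * (\sum_k g k l * z k)
      - eta y * (\sum_k u k * z k).
  under eq_bigr => k _ do rewrite mulrBl mulrDl mulr_suml -mulrA.
  rewrite sumrB big_split /= -!mulr_sumr exchange_big /=; congr (_ + _ - _).
  by apply: eq_bigr => l _; rewrite mulr_sumr;
     apply: eq_bigr => k _; rewrite mulrA.
rewrite /subsidy /gen_price /load_price !price bal.
rewrite /subsidy1 /subsidy2 /subsidy3 /welfare /flow.
under [X in _ = X + _ + _]eq_bigr => l _ do rewrite mulrBr.
rewrite sumrB [delta * kappa M * _]mulr_sumr.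
under [X in _ - X - _ = _]eq_bigr => i _ do rewrite -mulrA.
ring.
Qed.

End Market.

(* Main.v *)
Require Import Defs.
From mathcomp Require Import all_boot all_order all_algebra.
From mathcomp Require Import boolp classical_sets reals ring lra.

(** Write [W] for the optimal welfare, [w] for the welfare function and [E] for
    the monetized emissions [kappa * sum_i e_i p_i]. Since charging carbon at
    the rate [delta * kappa] instead of [kappa] adds [(1 - delta) * E] to the
    objective, the whole argument rests on computing the smallest optimal
    [eta] as a function of [delta].

    Every dual value is at least the market-clearing welfare of [x]
    ([dual_value_ge]), because the Lagrangian at [x] and an optimal shadow
    point exceeds it by nonnegative slack terms. That bound is attained with
    a given [eta] exactly when [x] still maximizes
    [welfare (delta * kappa) + eta * w] over the feasible dispatches: one
    direction reads the bound on the Lagrangian at a feasible dispatch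
    ([tight_dual_value]), the other takes as multipliers the dual solution of
    the linear program with this scalarized objective
    ([exact_penalty_multipliers]). The condition says
    [(1 - delta) * (E x' - E x) <= (1 + eta) * (W - w x')] for all feasible
    [x'], so it depends on [eta] and [delta] only through the ratio
    [t = (1 + eta) / (1 - delta)], and the nonnegative [t] for which it holds
    form a ray [t0 <= t] ([critical_slope]). Hence the smallest optimal [eta]
    is [max 0 (t0 * (1 - delta) - 1)] ([price_multipliersP]).

    That some [t] works at all is where uniqueness of [x] enters: over the
    feasible dispatches of welfare at least [W], that is over [x] alone,
    [E] is bounded by [E x], and the Farkas multiplier of the constraint
    [W <= w] in a certificate of this bound is such a [t]
    ([exists_dominates]).

    Budget balance [eta * W = delta * E] is now a scalar equation. It holds at
    [delta = 0] when [t0 <= 1] (then [eta = 0]) or when [W = 0]; otherwise it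
    is solved by [delta = W * (t0 - 1) / (E + t0 * W)], which is less than [1]
    because [0 <= E] and [0 < W]. Finally, tightness of the dual bound is
    complementary slackness for the line limits, so without congestion all
    line multipliers vanish and the congestion term of the subsidy with them
    ([uncongested_subsidy1]). *)

Set Implicit Arguments.
Unset Strict Implicit.
Unset Printing Implicit Defensive.
Import Order.TTheory GRing.Theory Num.Theory.
Local Open Scope ring_scope.

(** * Farkas' lemma *)

Section Farkas.
Variable R : realFieldType.

Lemma sum_unit_inr (T : finType) (F : unit + T -> R) :
  \sum_k F k = F (inl tt) + \sum_k F (inr k).
Proof. by rewrite big_sumType /= (big_pred1 tt) // => -[]. Qed.

Lemma scalar0 (V : lmodType R) (f : V -> R) : scalar f -> f 0 = 0.
Proof.
by move=> f_lin; have := f_lin (-1) 0 0; rewrite scaleN1r addNr mulN1r addNr.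
Qed.

Lemma scalarZ (V : lmodType R) (f : V -> R) c v :
  scalar f -> f (c *: v) = c * f v.
Proof. by move=> f_lin; have := f_lin c v 0; rewrite !addr0 scalar0 ?addr0. Qed.

Lemma scalarBZ (V : lmodType R) (f : V -> R) v c w :
  scalar f -> f (v - c *: w) = f v - c * f w.
Proof. by move=> f_lin; rewrite addrC -scaleNr f_lin mulNr addrC. Qed.

(** Bartl's induction on the number of forms. If the last form [a k] cannot be
    dropped, some [w] violates the implication for the other forms and has
    [a k w > 0]; projecting along [w] onto the kernel of [a k] reduces to the
    remaining forms, and [a k] gets whatever coefficient makes the identity
    hold at [w]. *)
Lemma farkas_cone (K : finType) (V : lmodType R) (a : K -> V -> R)
    (g : V -> R) :
    (forall k, scalar (a k)) -> scalar g ->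
    (forall v, (forall k, a k v <= 0) -> g v <= 0) ->
  exists2 z : K -> R, forall k, 0 <= z k & forall v, g v = \sum_k z k * a k v.
Proof.
move=> a_lin g_lin ag.
suff [z z_ge0 gE] : exists2 z : K -> R, forall k, 0 <= z k &
    forall v, g v = \sum_(k <- enum K) z k * a k v.
  by exists z => // v; rewrite gE big_enum.
(* Over a sequence of indices, so that the induction can drop its head. *)
have {ag} : forall v, (forall k, k \in enum K -> a k v <= 0) -> g v <= 0.
  by move=> v av; apply: ag => k; apply: av; rewrite mem_enum.
move: a g a_lin g_lin.
elim: (enum K) (enum_uniq K) => [|k s IHs] /=.
  move=> _ a g _ g_lin g_le0; exists (fun=> 0) => // v; rewrite big_nil.
  have {}g_le0 u : g u <= 0 by exact: g_le0.
  apply: le_anti; rewrite g_le0 //=.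
  by have := g_le0 (-1 *: v); rewrite scalarZ // mulN1r oppr_le0.
case/andP=> sk s_uniq a g a_lin g_lin ag.
have [ag'|] :=
  pselect (forall v, (forall j, j \in s -> a j v <= 0) -> g v <= 0).
  have [z z_ge0 gE] := IHs s_uniq a g a_lin g_lin ag'.
  exists (fun j => if j == k then 0 else z j) => [j|v]; first by case: ifP.
  rewrite big_cons eqxx mul0r add0r gE; apply: eq_big_seq => j js.
  by case: eqP => // jk; rewrite -jk js in sk.
move/existsNP=> [w /not_implyP[aw /negP]]; rewrite -ltNge => gw.
have akw : 0 < a k w.
  rewrite ltNge; apply/negP => akw; move: gw; rewrite ltNge ag // => j.
  by rewrite inE => /predU1P[->|/aw].
(* Project along w onto the kernel of the form a k. *)
pose u := (a k w)^-1 *: w.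
have aku : a k u = 1 by rewrite scalarZ // mulVf ?gt_eqF.
have au j : j \in s -> a j u <= 0.
  by move=> js; rewrite scalarZ // mulr_ge0_le0 ?aw // invr_ge0 ltW.
have gu : 0 < g u by rewrite scalarZ // mulr_gt0 ?invr_gt0.
pose pr f v : R := f v - a k v * f u.
have pr_lin f : scalar f -> scalar (pr f).
  by move=> f_lin c x y; rewrite /pr f_lin a_lin; ring.
have [|z z_ge0 gE] := IHs s_uniq (fun j => pr (a j)) (pr g)
  (fun j => pr_lin _ (a_lin j)) (pr_lin _ g_lin).
  move=> v av; rewrite /pr -scalarBZ //; apply: ag => j.
  rewrite inE => /predU1P[->|js]; first by rewrite scalarBZ // aku mulr1 subrr.
  by rewrite scalarBZ //; exact: av.
exists (fun j => if j == k then g u - \sum_(j <- s) z j * a j u else z j).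
  move=> j; case: ifP => // _; rewrite subr_ge0; apply: le_trans (ltW gu).
  rewrite big_seq sumr_le0 // => i js.
  by rewrite mulr_ge0_le0 ?au.
move=> v; rewrite big_cons eqxx.
pose c := g u - \sum_(j <- s) z j * a j u; rewrite -/c.
have -> : \sum_(j <- s) (if j == k then c else z j) * a j v =
    \sum_(j <- s) z j * a j v.
  apply: eq_big_seq => j js.
  by case: eqP => // jk; rewrite -jk js in sk.
have := gE v; rewrite /pr /c /=.
under eq_bigr => j _ do rewrite mulrBr mulrCA.
rewrite sumrB -mulr_sumr; lra.
Qed.

(** Affine version, by homogenization. The witness [x0] of feasibility excludes
    implications that hold vacuously, for which the only certificate may be one
    of infeasibility. *)
Lemma farkas (K : finType) (V : lmodType R) (a : K -> V -> R) (b : K -> R)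
    (g : V -> R) (c : R) (x0 : V) :
    (forall k, scalar (a k)) -> scalar g -> (forall k, a k x0 <= b k) ->
    (forall v, (forall k, a k v <= b k) -> g v <= c) ->
  exists z : K -> R, [/\ forall k, 0 <= z k,
    forall v, g v = \sum_k z k * a k v & \sum_k z k * b k <= c].
Proof.
move=> a_lin g_lin ax0 ag.
(* The homogenized system, in which the extra index inl tt imposes 0 <= t. *)
pose hom (f : V -> R) (e : R) (v : V * R^o) : R := f v.1 - e * v.2.
have hom_lin f e : scalar f -> scalar (hom f e).
  move=> f_lin s [v1 v2] [w1 w2]; rewrite /hom /= f_lin.
  by rewrite (_ : s *: v2 = s * v2) //; ring.
have snd_lin : scalar (fun v : V * R^o => - v.2 : R).
  move=> s [v1 v2] [w1 w2] /=.
  by rewrite (_ : s *: v2 = s * v2) //; ring.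
pose a' (k : unit + K) :=
  if k is inr k then hom (a k) (b k) else fun v => - v.2.
have [| |[v t] av|z z_ge0 gE] := @farkas_cone (unit + K)%type _ a' (hom g c).
- by case=> [_|k] //=; exact: hom_lin.
- exact: hom_lin.
- have t_ge0 : 0 <= t by have := av (inl tt); rewrite /= oppr_le0.
  have {}av k : a k v <= b k * t by have := av (inr k); rewrite /= subr_le0.
  rewrite /hom /= subr_le0.
  have [t_gt0|] := ltrP 0 t.
    have : g (t^-1 *: v) <= c.
      by apply: ag => k; rewrite scalarZ // mulrC ler_pdivrMr.
    by rewrite scalarZ // mulrC ler_pdivrMr.
  (* At t = 0, v is a recession direction: g is bounded above by c on the ray
     from x0 along v, so it cannot increase along it. *)
  move=> t_le0; have {t_le0 t_ge0} t0 : t = 0 by apply: le_anti; rewrite t_le0.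
  rewrite t0 mulr0 leNgt; apply/negP => gv.
  have gx0 := ag x0 ax0.
  pose m := (c - g x0 + 1) / g v.
  have m_ge0 : 0 <= m by rewrite divr_ge0 ?(ltW gv) // addr_ge0 // subr_ge0.
  have : g (m *: v + x0) <= c.
    apply: ag => k; rewrite a_lin; have := av k; rewrite t0 mulr0 => akv.
    by have := ax0 k; have := mulr_ge0_le0 m_ge0 akv; lra.
  by rewrite g_lin /m divfK ?gt_eqF //; lra.
exists (z \o inr); split=> [k|v|]; first exact: z_ge0.
  have := gE (v, 0).
  rewrite sum_unit_inr /hom /= !mulr0 subr0 oppr0 mulr0 add0r.
  move=> ->.
  by apply: eq_bigr => k _; rewrite /= /hom /= mulr0 subr0.
have := gE (0, 1); rewrite sum_unit_inr /hom /= scalar0 // mulr1 sub0r mulrN1.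
under eq_bigr => k _ do rewrite /= /hom /= scalar0 // mulr1 sub0r mulrN.
rewrite sumrN; have := z_ge0 (inl tt); lra.
Qed.

(** Two-sided constraints, equalities being the case of equal bounds: the
    certificate may use each form with either sign. *)
Lemma farkas_ranged (K : finType) (V : lmodType R) (a : K -> V -> R)
    (lo up : K -> R) (g : V -> R) (c : R) (x0 : V) :
    (forall k, scalar (a k)) -> scalar g ->
    (forall k, lo k <= a k x0 <= up k) ->
    (forall v, (forall k, lo k <= a k v <= up k) -> g v <= c) ->
  exists zl zu : K -> R, [/\ forall k, 0 <= zl k, forall k, 0 <= zu k,
    forall v, g v = \sum_k (zu k - zl k) * a k v &
    \sum_k (zu k * up k - zl k * lo k) <= c].
Proof.
move=> a_lin g_lin ax0 ag.
pose a' (k : K + K) v := match k with inl k => - a k v | inr k => a k v end.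
pose b (k : K + K) := match k with inl k => - lo k | inr k => up k end.
have [|//| | |z [z_ge0 gE zb]] := @farkas _ _ a' b g c x0.
- by case=> k s v w; rewrite /= a_lin //; ring.
- by case=> k; have /andP[] := ax0 k; rewrite /= ?lerN2.
- move=> v av; apply: ag => k.
  by have := av (inl k); have := av (inr k); rewrite /= lerN2 => -> ->.
exists (z \o inl), (z \o inr); split=> [k|k|v|]; try exact: z_ge0.
  rewrite gE big_sumType /= addrC -big_split /=; apply: eq_bigr => k _.
  by rewrite mulrN mulrBl.
apply: le_trans zb; rewrite big_sumType /= addrC -big_split /=.
by under [X in _ <= X]eq_bigr => k _ do rewrite mulrN.
Qed.

End Farkas.

(** * Linear programming duality for the welfare problem *)

Section WelfareDuality.
Variables (R : realType) (I J L : finType).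
Implicit Types (M : market R I J L) (x : dispatch R I J).

Local Notation vec := ({ffun I -> R^o} * {ffun J -> R^o})%type.
Local Notation constraint := (unit + (I + (J + L)))%type.

(** Dispatches carry no module structure of their own; Farkas' lemma is applied
    on this product of function spaces. *)
Definition of_vec (v : vec) : dispatch R I J := Dispatch v.1 v.2.
Definition to_vec x : vec := (production x, consumption x).

Definition total_emission M x : R := \sum_i emission M i * production x i.

Definition activity M (k : constraint) (v : vec) : R :=
  match k with
  | inl _ => \sum_i v.1 i - \sum_j v.2 j
  | inr (inl i) => v.1 i
  | inr (inr (inl j)) => v.2 j
  | inr (inr (inr l)) => flow M (of_vec v) l
  end.

Definition lower_bound M (k : constraint) : R :=
  if k is inr (inr (inr l)) then - capacity M l else 0.

Definition upper_bound M (k : constraint) : R :=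
  match k with
  | inl _ => 0
  | inr (inl i) => pmax M i
  | inr (inr (inl j)) => dmax M j
  | inr (inr (inr l)) => capacity M l
  end.

Lemma of_vecK x : of_vec (to_vec x) = x. Proof. by case: x. Qed.

Lemma sw_feasibleP M v :
  sw_feasible M (of_vec v) <->
  forall k, lower_bound M k <= activity M k v <= upper_bound M k.
Proof.
split=> [[bal [prod cons] lines] [[]|[i|[j|l]]] //=|rows].
  by rewrite subr_ge0 subr_le0 bal lexx.
split; last by move=> l; exact: (rows (inr (inr (inr l)))).
  by apply/eqP; rewrite -subr_eq0 eq_le andbC; exact: (rows (inl tt)).
split=> [i|j]; first exact: (rows (inr (inl i))).
exact: (rows (inr (inr (inl j)))).
Qed.

Lemma sum_scalar (T : finType) (c : T -> R) s (f h : {ffun T -> R^o}) :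
  \sum_k c k * (s *: f + h) k = s * (\sum_k c k * f k) + \sum_k c k * h k.
Proof.
rewrite mulr_sumr -big_split; apply: eq_bigr => k _.
by rewrite !ffunE mulrDr mulrCA.
Qed.

Lemma dispatch_scalar (c : I -> R) (b : J -> R) :
  scalar (fun v : vec => \sum_i c i * v.1 i - \sum_j b j * v.2 j).
Proof. by move=> s v w; rewrite !sum_scalar; ring. Qed.

Lemma activity_scalar M k : scalar (activity M k).
Proof.
case: k => [[]|[i|[j|l]]] s v w; rewrite /= ?ffunE //.
  have := dispatch_scalar (fun=> 1) (fun=> 1) s v w.
  have sum1 (T : finType) (f : T -> R) : \sum_k 1 * f k = \sum_k f k.
    by apply: eq_bigr => k _; rewrite mul1r.
  by rewrite /= !sum1.
exact: dispatch_scalar.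
Qed.

Lemma welfare_scalar M r : scalar (fun v : vec => welfare M r (of_vec v)).
Proof. by move=> s v w; rewrite /welfare !sum_scalar; ring. Qed.

Lemma emission_scalar M a :
  scalar (fun v : vec => a * total_emission M (of_vec v)).
Proof. by move=> s v w; rewrite /total_emission sum_scalar; ring. Qed.

(** This isolates [delta] in a factor of the emissions, so that the exactness of
    a penalty depends on its rate and on [delta] through a ratio only. *)
Lemma welfareE M delta x : welfare M (delta * kappa M) x =
  welfare M (kappa M) x + (1 - delta) * (kappa M * total_emission M x).
Proof.
rewrite /welfare /total_emission mulr_sumr mulr_sumr -addrA; congr (_ + _).
rewrite -!sumrN -big_split; apply: eq_bigr => i _ /=; ring.
Qed.

Lemma welfare_shadowE M s x : shadow_feasible M s ->
  welfare M (kappa M) x =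
  \sum_i (mu_up s i - mu_lo s i) * production x i
  + \sum_j (phi_up s j - phi_lo s j) * consumption x j
  - lam s * (\sum_i production x i - \sum_j consumption x j)
  - \sum_l (chi_up s l - chi_lo s l) * flow M x l.
Proof.
case=> gen load _ _ _; rewrite /welfare.
have -> : \sum_j utility M j * consumption x j =
    lam s * (\sum_j consumption x j)
    + \sum_j (phi_up s j - phi_lo s j) * consumption x j
    + \sum_l (chi_up s l - chi_lo s l)
        * (\sum_j load_factor M j l * consumption x j).
  under [X in _ + _ + X]eq_bigr do rewrite mulr_sumr.
  rewrite exchange_big mulr_sumr -!big_split; apply: eq_bigr => j _ /=.
  rewrite -load; under [X in _ = _ + X]eq_bigr do rewrite mulrCA mulrA.
  by rewrite -mulr_suml; ring.
have -> : \sum_i (cost M i + kappa M * emission M i) * production x i =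
    lam s * (\sum_i production x i)
    - \sum_i (mu_up s i - mu_lo s i) * production x i
    + \sum_l (chi_up s l - chi_lo s l)
        * (\sum_i gen_factor M i l * production x i).
  under [X in _ + _ + X]eq_bigr do rewrite mulr_sumr.
  rewrite exchange_big mulr_sumr -sumrN -!big_split; apply: eq_bigr => i _ /=.
  under [X in _ = _ + X]eq_bigr do rewrite mulrCA mulrA.
  rewrite -mulr_suml.
  have := gen i; set S := \sum_l _; set c := cost M i + _ => genE.
  by rewrite (_ : c = lam s + mu_lo s i - mu_up s i + S) //; [ring|lra].
rewrite /flow; under [X in _ = _ - X]eq_bigr do rewrite mulrBr.
rewrite sumrB; ring.
Qed.

(** Pricing the balance and line constraints with a feasible shadow point leaves
    only the box multipliers, which the box bounds absorb. The left-hand side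
    is a Lagrangian with [chi_up] on the lower line limits and [chi_lo] on the
    upper ones, so a shadow point doubles as a system of multipliers. *)
Lemma relaxed_welfare_le M s x : shadow_feasible M s -> in_box M x ->
  welfare M (kappa M) x
  + lam s * (\sum_i production x i - \sum_j consumption x j)
  + \sum_l chi_up s l * (capacity M l + flow M x l)
  + \sum_l chi_lo s l * (capacity M l - flow M x l) <= shadow_cost M s.
Proof.
move=> sF [prod cons]; rewrite (welfare_shadowE x sF) /shadow_cost.
case: sF => _ _ mu phi _.
have pleq : \sum_i (mu_up s i - mu_lo s i) * production x i <=
    \sum_i mu_up s i * pmax M i.
  apply: ler_sum => i _; have [mul muu] := mu i; have /andP[p0 pp] := prod i.
  by have := ler_wpM2l muu pp; have := mulr_ge0 mul p0; lra.
have dleq : \sum_j (phi_up s j - phi_lo s j) * consumption x j <=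
    \sum_j phi_up s j * dmax M j.
  apply: ler_sum => j _; have [mul muu] := phi j; have /andP[p0 pp] := cons j.
  by have := ler_wpM2l muu pp; have := mulr_ge0 mul p0; lra.
have -> : \sum_l (chi_up s l + chi_lo s l) * capacity M l =
    \sum_l chi_up s l * (capacity M l + flow M x l)
    + \sum_l chi_lo s l * (capacity M l - flow M x l)
    - \sum_l (chi_up s l - chi_lo s l) * flow M x l.
  by rewrite -sumrN -!big_split; apply: eq_bigr => l _ /=; ring.
lra.
Qed.

Lemma line_slack_ge0 M x (a : L -> R) :
    sw_feasible M x -> (forall l, 0 <= a l) ->
  0 <= \sum_l a l * (capacity M l + flow M x l) /\
  0 <= \sum_l a l * (capacity M l - flow M x l).
Proof.
case=> _ _ lines a0; split; apply: sumr_ge0 => l _; apply: mulr_ge0 => //;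
  have /andP[] := lines l; lra.
Qed.

Lemma weak_duality M s x : shadow_feasible M s -> sw_feasible M x ->
  welfare M (kappa M) x <= shadow_cost M s.
Proof.
move=> sF xF; have [bal xb _] := xF; have := relaxed_welfare_le sF xb.
have [_ _ _ _ chi] := sF.
have [up _] := line_slack_ge0 xF (fun l => proj2 (chi l)).
have [_ lo] := line_slack_ge0 xF (fun l => proj1 (chi l)).
by rewrite bal subrr mulr0; lra.
Qed.

(** The shadow point is read off the Farkas certificate of the bound on the
    welfare, tested on the unit vectors; the box multipliers are the
    certificate coefficients of the box constraints. *)
Lemma strong_duality M x : sw_optimal M x ->
  exists2 s, shadow_feasible M s & shadow_cost M s <= welfare M (kappa M) x.
Proof.
case=> xF x_max.
have [|v vF|zl [zu [zl0 zu0 wE cost_le]]] :=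
  farkas_ranged (activity_scalar M) (welfare_scalar M (kappa M))
    (lo := lower_bound M) (up := upper_bound M)
    (c := welfare M (kappa M) x) (x0 := to_vec x).
- by apply/sw_feasibleP; rewrite of_vecK.
- by apply: x_max; apply/sw_feasibleP.
pose zi i : constraint := inr (inl i).
pose zj j : constraint := inr (inr (inl j)).
pose zk l : constraint := inr (inr (inr l)).
(* The shadow constraints count lam and chi_up against the balance and line
   activities, hence the exchange of lower and upper coefficients there. *)
exists (Shadow (zl (inl tt) - zu (inl tt))
  [ffun i => zl (zi i)] [ffun i => zu (zi i)]
  [ffun j => zl (zj j)] [ffun j => zu (zj j)]
  [ffun l => zu (zk l)] [ffun l => zl (zk l)]).
  have sum_delta (T : finType) (f : T -> R) (t : T) :
      \sum_k f k * [ffun k => (k == t)%:R : R^o] k = f t.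
    rewrite (bigD1 t) //= big1 ?ffunE ?eqxx ?mulr1 ?addr0 // => k /negPf kt.
    by rewrite ffunE kt mulr0.
  have sum_zero (T : finType) (f : T -> R) :
      \sum_k f k * (0 : {ffun T -> R^o}) k = 0.
    by rewrite big1 // => k _; rewrite ffunE mulr0.
  have sum_one (T : finType) (t : T) :
      \sum_k [ffun k => (k == t)%:R : R^o] k = 1.
    rewrite -[RHS](sum_delta T (fun=> 1) t).
    by apply: eq_bigr => k _; rewrite mul1r.
  have sum_zero1 (T : finType) : \sum_k (0 : {ffun T -> R^o}) k = 0.
    by rewrite big1 // => k _; rewrite ffunE.
  split=> [i|j|i|j|l] /=; rewrite ?ffunE //.
    have := wE ([ffun k => (k == i)%:R], 0).
    rewrite sum_unit_inr !big_sumType /welfare /= /flow /= sum_delta.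
    rewrite !sum_zero sum_one sum_zero1 sum_delta subr0 mulr1 sub0r add0r.
    under eq_bigr => l _ do rewrite sum_delta sum_zero subr0 mulrC.
    under [X in _ -> _ - X = _]eq_bigr => l _ do rewrite !ffunE -opprB mulrN.
    by move=> ->; rewrite sumrN; ring.
  have := wE (0, [ffun k => (k == j)%:R]).
  rewrite sum_unit_inr !big_sumType /welfare /= /flow /= sum_delta.
  rewrite !sum_zero sum_one sum_zero1 sum_delta subr0 sub0r add0r.
  under eq_bigr => l _ do rewrite sum_delta sum_zero sub0r mulrN mulrC.
  under [X in _ -> _ + X = _]eq_bigr => l _ do rewrite !ffunE -opprB mulrN.
  by move=> ->; rewrite sumrN; ring.
apply: le_trans cost_le.
rewrite sum_unit_inr !big_sumType /shadow_cost /= !mulr0 subrr add0r addrA.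
apply: lerD; first apply: lerD; apply: ler_sum => k _;
  rewrite !ffunE ?mulr0 ?subr0 //.
by rewrite mulrN opprK mulrDl addrC.
Qed.

(** The exchange rate [t] between welfare and monetized emissions stands for
    [(1 + eta) / (1 - delta)], see [exact_penaltyP]. *)
Definition dominates M x (t : R) : Prop :=
  forall x', sw_feasible M x' ->
    kappa M * total_emission M x' - kappa M * total_emission M x <=
    t * (welfare M (kappa M) x - welfare M (kappa M) x').

(** Adding the constraint [W <= w] to the feasible set leaves the single point
    [x], on which emissions are trivially bounded. In a certificate of this
    bound the multiplier of the added constraint is the exchange rate. As
    [W] also bounds the welfare from above, the constraint is imposed as an
    equality. *)
Lemma exists_dominates M x : sw_optimal M x ->
    (forall x', sw_optimal M x' -> x' = x) ->
  exists2 t, 0 <= t & dominates M x t.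
Proof.
move=> [xF x_max] x_uniq; set W := welfare M (kappa M) x.
pose a (k : unit + constraint) v :=
  if k is inr k then activity M k v else welfare M (kappa M) (of_vec v).
pose lo (k : unit + constraint) := if k is inr k then lower_bound M k else W.
pose up (k : unit + constraint) := if k is inr k then upper_bound M k else W.
have [[?|k]||v av|zl [zu [zl0 zu0 EE bound]]] :=
  @farkas_ranged _ (unit + constraint)%type _ a lo up _
    (kappa M * total_emission M x) (to_vec x) _ (emission_scalar M (kappa M)).
- exact: welfare_scalar.
- exact: activity_scalar.
- case=> [_|k] /=; first by rewrite of_vecK lexx.
  by apply: (proj1 (sw_feasibleP M _)); rewrite of_vecK.
- have vF : sw_feasible M (of_vec v).
    by apply/sw_feasibleP => k; exact: (av (inr k)).
  have /andP[Wv _] := av (inl tt).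
  rewrite (x_uniq (of_vec v)) //; split=> // x' x'F.
  exact: le_trans (x_max x' x'F) Wv.
exists (zl (inl tt)) => // x' x'F.
have := EE (to_vec x'); rewrite of_vecK => ->.
have : \sum_k (zu (inr k) - zl (inr k)) * activity M k (to_vec x') <=
    \sum_k (zu (inr k) * upper_bound M k - zl (inr k) * lower_bound M k).
  apply: ler_sum => k _.
  have /andP[klo kup] :
      lower_bound M k <= activity M k (to_vec x') <= upper_bound M k.
    by apply: (proj1 (sw_feasibleP M _)); rewrite of_vecK.
  have := ler_wpM2l (zl0 (inr k)) klo; have := ler_wpM2l (zu0 (inr k)) kup; lra.
have : zu (inl tt) * W - zl (inl tt) * W
    + \sum_k (zu (inr k) * upper_bound M k - zl (inr k) * lower_bound M k) <=
    kappa M * total_emission M x by rewrite sum_unit_inr in bound.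
have -> : \sum_k (zu k - zl k) * a k (to_vec x') =
    (zu (inl tt) - zl (inl tt)) * welfare M (kappa M) x'
    + \sum_k (zu (inr k) - zl (inr k)) * activity M k (to_vec x').
  by rewrite sum_unit_inr [a (inl tt) _]/(welfare _ _ _) of_vecK.
have := mulr_ge0 (zu0 (inl tt)) (_ : 0 <= W - welfare M (kappa M) x').
rewrite subr_ge0 -/W => /(_ (x_max _ x'F)); lra.
Qed.

(** Larger exchange rates dominate because welfare losses are nonnegative, and
    the infimum dominates because each feasible dispatch imposes a closed
    condition. A dispatch without welfare loss imposes one independent of [t],
    which holds since some [t] dominates. *)
Lemma critical_slope M x : sw_optimal M x ->
    (forall x', sw_optimal M x' -> x' = x) ->
  exists2 t0, 0 <= t0 & forall t, 0 <= t -> (dominates M x t <-> t0 <= t).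
Proof.
move=> x_opt x_uniq; have [t1 t1_ge0 t1_dom] := exists_dominates x_opt x_uniq.
have W_max x' (x'F : sw_feasible M x') :
    0 <= welfare M (kappa M) x - welfare M (kappa M) x'.
  by rewrite subr_ge0; apply: (proj2 x_opt).
pose S := [set t | 0 <= t /\ dominates M x t]%classic.
have S_n0 : (S !=set0)%classic by exists t1.
exists (inf S) => [|t t_ge0]; first by apply: lb_le_inf => // t [].
split=> [t_dom|inf_t x' x'F].
  by apply: ge_inf; [exists 0 => u [] | split].
apply: le_trans (ler_wpM2r (W_max _ x'F) inf_t).
have := W_max _ x'F; rewrite le_eqVlt => /predU1P[gap0|gap_gt0].
  by have := t1_dom _ x'F; rewrite -gap0 !mulr0.
rewrite -ler_pdivrMr //; apply: lb_le_inf => // u [_ u_dom].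
by rewrite ler_pdivrMr //; exact: u_dom.
Qed.

End WelfareDuality.

(** * The dual of the market-clearing problem *)

Section MarketClearing.
Variables (R : realType) (I J L : finType) (M : market R I J L).
Variable x : dispatch R I J.
Hypothesis x_opt : sw_optimal M x.
Implicit Types (s : shadow R I J L) (y : multipliers R L) (delta : R).

(** Penalizing the loss of social welfare at the rate [e] makes the constraint
    that forces social optimality superfluous. *)
Definition exact_penalty delta (e : R) : Prop :=
  forall x', sw_feasible M x' ->
    welfare M (delta * kappa M) x'
    + e * (welfare M (kappa M) x' - welfare M (kappa M) x)
    <= welfare M (delta * kappa M) x.

Lemma exact_penaltyP delta e : delta < 1 ->
  exact_penalty delta e <-> dominates M x ((1 + e) / (1 - delta)).
Proof.
move=> d1; have d1' : 0 < 1 - delta by rewrite subr_gt0.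
have key x' : (welfare M (delta * kappa M) x'
    + e * (welfare M (kappa M) x' - welfare M (kappa M) x)
    <= welfare M (delta * kappa M) x) =
    (kappa M * total_emission M x' - kappa M * total_emission M x <=
     (1 + e) / (1 - delta) * (welfare M (kappa M) x - welfare M (kappa M) x')).
  by rewrite mulrAC ler_pdivlMr // !welfareE; apply/idP/idP; lra.
by split=> pen x' x'F; move: (pen x' x'F); rewrite key.
Qed.

(** Lower bound on the inner maximum: the shadow point is fixed at an optimal
    one, so the duality-gap term reduces to the welfare loss. *)
Lemma lagrangian_ge delta y s x' : dual_feasible y -> sw_feasible M x' ->
    shadow_cost M s <= welfare M (kappa M) x ->
  welfare M (delta * kappa M) x'
  + \sum_l alpha_lo y l * (capacity M l + flow M x' l)
  + \sum_l alpha_up y l * (capacity M l - flow M x' l)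
  + eta y * (welfare M (kappa M) x' - welfare M (kappa M) x)
  <= lagrangian M delta y x' s.
Proof.
move=> [_ eta0] [bal _ _] cost_le; rewrite /lagrangian bal subrr mulr0 addr0.
by rewrite lerD2l ler_wpM2l // addrC lerD2r lerN2.
Qed.

Lemma slack_ge0 y x' : dual_feasible y -> sw_feasible M x' ->
  0 <= \sum_l alpha_lo y l * (capacity M l + flow M x' l) /\
  0 <= \sum_l alpha_up y l * (capacity M l - flow M x' l).
Proof.
move=> [alpha0 _] x'F.
have [lo _] := line_slack_ge0 x'F (fun l => proj1 (alpha0 l)).
by have [_ up] := line_slack_ge0 x'F (fun l => proj2 (alpha0 l)).
Qed.

Lemma dual_value_ge delta y v : dual_feasible y -> dual_value M delta y v ->
  welfare M (delta * kappa M) x <= v.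
Proof.
move=> yF [_ v_ub]; have [s sF s_opt] := strong_duality x_opt.
have [xF _] := x_opt; have [lo up] := slack_ge0 yF xF.
have := lagrangian_ge delta yF xF s_opt.
have : lagrangian M delta y x s <= v.
  by apply: v_ub; exists x, s; split=> //; case: xF.
by rewrite subrr mulr0; lra.
Qed.

(** At the smallest possible dual value, the Lagrangian has no room left: the
    penalty is exact and, at [x] itself, complementary slackness holds. *)
Lemma tight_dual_value delta y : dual_feasible y ->
    dual_value M delta y (welfare M (delta * kappa M) x) ->
  [/\ exact_penalty delta (eta y),
      \sum_l alpha_lo y l * (capacity M l + flow M x l) = 0 &
      \sum_l alpha_up y l * (capacity M l - flow M x l) = 0].
Proof.
move=> yF [_ v_ub]; have [s sF s_opt] := strong_duality x_opt.
have le_opt x' : sw_feasible M x' ->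
    lagrangian M delta y x' s <= welfare M (delta * kappa M) x.
  by move=> [_ x'b _]; apply: v_ub; exists x', s.
split.
- move=> x' x'F; have [lo up] := slack_ge0 yF x'F.
  by have := lagrangian_ge delta yF x'F s_opt; have := le_opt _ x'F; lra.
all: have [xF _] := x_opt; have [lo up] := slack_ge0 yF xF.
all: have := lagrangian_ge delta yF xF s_opt; have := le_opt _ xF.
all: by rewrite subrr mulr0; lra.
Qed.

(** For a fixed [e], eliminating the shadow variables turns the dual of the
    market-clearing problem into that of a welfare problem with this objective.
    Presenting it as a market, with the emission charge moved into the cost,
    lets [strong_duality] apply to it. *)
Definition scalarized delta (e : R) : market R I J L :=
  Market
    (fun i => (cost M i + delta * kappa M * emission M i)
              + e * (cost M i + kappa M * emission M i))
    (fun j => (1 + e) * utility M j) (gen_factor M) (load_factor M)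
    (emission_ge0 M) (pmax_ge0 M) (dmax_ge0 M) (capacity_ge0 M) (lexx (0 : R)).

Lemma scalarized_welfare delta e x' :
  welfare (scalarized delta e) (kappa (scalarized delta e)) x' =
  welfare M (delta * kappa M) x' + e * welfare M (kappa M) x'.
Proof.
rewrite /welfare !mulrBr !mulr_sumr addrACA -opprD -!big_split /=.
by congr (_ - _); apply: eq_bigr => k _; ring.
Qed.

Lemma exact_penalty_multipliers delta e : 0 <= e -> exact_penalty delta e ->
  exists y, [/\ eta y = e, dual_feasible y &
    dual_value M delta y (welfare M (delta * kappa M) x)].
Proof.
move=> e0 pen; have [xF _] := x_opt; have [s sF s_opt] := strong_duality x_opt.
have [|s' s'F s'_opt] := @strong_duality _ _ _ _ (scalarized delta e) x.
  split=> [|x' x'F]; first exact: xF.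
  by rewrite !scalarized_welfare; have := pen x' x'F; lra.
pose y := Multipliers (lam s') (chi_up s') (chi_lo s') e.
have yF : dual_feasible y.
  by case: s'F => _ _ _ _ chi; split=> //= l; have [] := chi l.
have y_ub :
    ubound (lagrangian_values M delta y) (welfare M (delta * kappa M) x).
  move=> _ [x1 [s1 [x1b s1F ->]]].
  have := le_trans (relaxed_welfare_le s'F x1b) s'_opt.
  rewrite !scalarized_welfare.
  have := ler_wpM2l e0 (weak_duality s1F xF).
  by rewrite /lagrangian /=; lra.
exists y; split=> //; split=> //; exists x, s; split=> //; first by case: xF.
have [lo up] := slack_ge0 yF xF.
have := lagrangian_ge delta yF xF s_opt; rewrite subrr mulr0 => Lge.
apply: le_anti; apply/andP; split; first by lra.
by apply: y_ub; exists x, s; split=> //; case: xF.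
Qed.

Hypothesis x_uniq : forall x', sw_optimal M x' -> x' = x.

(** The dual optima are the multipliers with the value of [x], and the [eta]
    that occur among them are those above a threshold, which is therefore the
    selected one. *)
Lemma price_multipliersP : exists2 t0, 0 <= t0 &
  forall delta, 0 <= delta < 1 ->
    (exists y, price_multipliers M delta y) /\
    forall y, price_multipliers M delta y ->
      [/\ eta y = Num.max 0 (t0 * (1 - delta) - 1), dual_feasible y &
          dual_value M delta y (welfare M (delta * kappa M) x)].
Proof.
have [t0 t0_ge0 t0P] := critical_slope x_opt x_uniq.
exists t0 => // delta /andP[d0 d1]; set e0 := Num.max _ _.
have e0_ge0 : 0 <= e0 by rewrite /e0 le_max lexx.
have penP e : 0 <= e -> exact_penalty delta e <-> e0 <= e.
  move=> e_ge0; have d1' : 0 < 1 - delta by rewrite subr_gt0.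
  rewrite /e0 ge_max e_ge0 /= lerBlDl -ler_pdivlMr //.
  apply: iff_trans (exact_penaltyP e d1) _; apply: t0P.
  by rewrite divr_ge0 ?(ltW d1') // addr_ge0.
have [y0 [y0e y0F y0v]] :=
  exact_penalty_multipliers e0_ge0 (proj2 (penP _ e0_ge0) (lexx _)).
have optP y : dual_optimal M delta y ->
    dual_feasible y /\ dual_value M delta y (welfare M (delta * kappa M) x).
  move=> [yF [v v_val v_lb]]; split=> //.
  suff <- : v = welfare M (delta * kappa M) x by [].
  apply: le_anti; rewrite (dual_value_ge yF v_val) andbT.
  by apply: v_lb; exists y0.
have y0_opt : dual_optimal M delta y0.
  split=> //; exists (welfare M (delta * kappa M) x) => // v [y yF yv].
  exact: dual_value_ge yF yv.
have eta_ge y : dual_optimal M delta y -> e0 <= eta y.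
  move=> /optP[yF yv]; have [pen _ _] := tight_dual_value yF yv.
  by apply/penP => //; case: yF.
split=> [|y [y_opt y_min]].
  by exists y0; split=> // y' /eta_ge; rewrite y0e.
have [yF yv] := optP y y_opt; split=> //.
by apply: le_anti; rewrite -{1}y0e y_min //= eta_ge.
Qed.

(** The dispatch in which nothing is traded is feasible. *)
Lemma welfare_ge0 : 0 <= welfare M (kappa M) x.
Proof.
have sum0 (T : finType) (f : T -> R) (h : {ffun T -> R}) :
    (forall k, h k = 0) -> \sum_k f k * h k = 0.
  by move=> h0; rewrite big1 // => k _; rewrite h0 mulr0.
pose x0 : dispatch R I J := Dispatch [ffun=> 0] [ffun=> 0].
have [_ /(_ x0)] := x_opt.
rewrite {1}/welfare !sum0 ?subr0; try by move=> k; rewrite ffunE.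
apply; split=> [||l] /=; first by rewrite !big1 // => k _; rewrite ffunE.
  by split=> k; rewrite ffunE lexx ?pmax_ge0 ?dmax_ge0.
rewrite /flow !sum0 ?subr0; try by move=> k; rewrite ffunE.
by rewrite oppr_le0 capacity_ge0.
Qed.

Lemma total_emission_ge0 : 0 <= total_emission M x.
Proof.
have [[_ [prod _] _] _] := x_opt; apply: sumr_ge0 => i _.
by rewrite mulr_ge0 ?emission_ge0 //; have /andP[] := prod i.
Qed.

(** Complementary slackness: away from its limits, a line has zero multipliers. *)
Lemma uncongested_subsidy1 delta y : dual_feasible y ->
    dual_value M delta y (welfare M (delta * kappa M) x) ->
  uncongested M x -> subsidy1 M y x = 0.
Proof.
move=> yF yv unc; have [_ lo0 up0] := tight_dual_value yF yv.
have [alpha0 _] := yF; have [[_ _ lines] _] := x_opt.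
rewrite /subsidy1 big1 // => l _; have [al au] := alpha0 l.
have /andP[fl fu] := lines l; have [nl nu] := unc l.
have slack_eq0 (a b : L -> R) : (forall l, 0 <= a l * b l) ->
    \sum_l a l * b l = 0 -> b l != 0 -> a l = 0.
  move=> ab0 sum0 bl; apply/eqP.
  have /eqP := @psumr_eq0P _ _ _ _ (fun k _ => ab0 k) sum0 l isT.
  by rewrite mulf_eq0 (negPf bl) orbF.
have lineF k : 0 <= capacity M k + flow M x k /\ 0 <= capacity M k - flow M x k.
  by have /andP[] := lines k; split; lra.
rewrite (slack_eq0 (alpha_lo y) _ _ lo0); first last.
- by apply/eqP => slack0; apply: nl; lra.
- by move=> k; rewrite mulr_ge0 //; case: (alpha0 k) (lineF k) => ? ? [].
rewrite (slack_eq0 (alpha_up y) _ _ up0); first last.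
- by apply/eqP => slack0; apply: nu; lra.
- by move=> k; rewrite mulr_ge0 //; case: (alpha0 k) (lineF k) => ? ? [].
by rewrite subrr mul0r.
Qed.

End MarketClearing.

(** * Budget balance *)

Theorem proposition1 (R : realType) (I J L : finType) (M : market R I J L)
    (x : dispatch R I J) (x_opt : sw_optimal M x)
    (x_uniq : forall x', sw_optimal M x' -> x' = x) :
  (exists delta : R,
     [/\ 0 <= delta < 1,
         exists y : multipliers R L, price_multipliers M delta y &
         forall y : multipliers R L, price_multipliers M delta y ->
           delta_subsidy M delta y x = 0]) /\
  (forall (delta : R) (y : multipliers R L), 0 <= delta < 1 ->
     price_multipliers M delta y -> delta_subsidy M delta y x = 0 ->
     uncongested M x -> subsidy M delta y x = 0).
Proof.
have [t0 t0_ge0 pricesP] := price_multipliersP x_opt x_uniq.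
split; last first.
  move=> delta y d01 y_price balanced unc; have [xF _] := x_opt.
  have [_ /(_ y y_price)[_ yF yv]] := pricesP delta d01.
  have [bal _ _] := xF.
  rewrite subsidyE // (uncongested_subsidy1 x_opt yF yv unc) add0r.
  exact: balanced.
pose W := welfare M (kappa M) x; pose E := kappa M * total_emission M x.
have W_ge0 : 0 <= W by exact: welfare_ge0.
have E_ge0 : 0 <= E by rewrite mulr_ge0 ?kappa_ge0 // total_emission_ge0.
suff [delta d01 root] : exists2 delta, 0 <= delta < 1 &
    Num.max 0 (t0 * (1 - delta) - 1) * W = delta * E.
  have [y_ex yP] := pricesP delta d01.
  exists delta; split=> // y /yP[eta_y _ _].
  by rewrite /delta_subsidy /subsidy2 /subsidy3 eta_y root -mulrA addNr.
have [t0_le1|t0_gt1] := lerP t0 1.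
  exists 0; first by rewrite lexx ltr01.
  by rewrite subr0 mulr1 mul0r max_l ?mul0r // subr_le0.
have [W_eq0|W_neq0] := eqVneq W 0.
  by exists 0; [rewrite lexx ltr01 | rewrite W_eq0 mulr0 mul0r].
have W_gt0 : 0 < W by rewrite lt_neqAle eq_sym W_neq0.
have D_gt0 : 0 < E + t0 * W by rewrite ltr_wpDl // mulr_gt0 //; lra.
(* The root of (t0 * (1 - delta) - 1) * W = delta * E. *)
pose delta := W * (t0 - 1) / (E + t0 * W).
have deltaE : delta * (E + t0 * W) = W * (t0 - 1) by rewrite divfK // gt_eqF.
have d_ge0 : 0 <= delta by rewrite divr_ge0 ?(ltW D_gt0) // mulr_ge0 //; lra.
exists delta.
  by rewrite d_ge0 /= ltr_pdivrMr // mul1r mulrBr mulr1 mulrC; lra.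
have etaE : (t0 * (1 - delta) - 1) * W = delta * E by lra.
(* The maximum is its affine branch: this branch times the positive W is
   delta * E, which is nonnegative. *)
rewrite max_r //; have := mulr_ge0 d_ge0 E_ge0.
by rewrite -etaE pmulr_lge0.
Qed.
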